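(* Consider the networked system $\dot X=\Phi X$, $Y=\Psi X$ with $\Phi=I_N\otimes A+L\otimes H$ and $\Psi=\Delta\otimes C$, and let $\bar\Phi=I_N\otimes A+\bar L\otimes H$. Let $V_{ij}$, $\Gamma(\mu)$ (for $L$) and $\bar V_{ij}$, $\bar\Gamma(\mu)$ (for $\bar L$) be the subspaces and index sets built from (generalized) Jordan chains as defined in the context. The topological change $L\to\bar L$ is $\Psi$-discernible if and only if for all $\mu\in\sigma(\Phi)\cup\sigma(\bar\Phi)$ the following two conditions hold simultaneously: (1) $\Big\{\bigoplus_{(i,j)\in\Gamma(\mu)}V_{ij}\Big\}\cap\Big\{\bigoplus_{(i,j)\in\bar\Gamma(\mu)}\bar V_{ij}\Big\}=\{\mathbf 0_{Nn}\}$; (2) $\mathcal N(\Delta\otimes C)\cap\Big\{\Big\{\bigoplus_{(i,j)\in\Gamma(\mu)}V_{ij}\Big\}\oplus\Big\{\bigoplus_{(i,j)\in\bar\Gamma(\mu)}\bar V_{ij}\Big\}\Big\}=\{\mathbf 0_{Nn}\}$.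
   Context: Setting. $N\ge 2$; $A\in\mathbb R^{n\times n}$, $H\in\mathbb R^{n\times n}$, $C\in\mathbb R^{p\times n}$. $L=[w_{ij}]\in\mathbb R^{N\times N}$ is the weight matrix of a directed weighted graph on $N$ nodes, with $w_{ii}=0$ and $w_{ij}\ne 0$ exactly when there is an edge from node $j$ to node $i$ (weights are otherwise arbitrary real numbers). $\Delta=\mathrm{diag}\{\delta_1,\dots,\delta_N\}$ with $\delta_i=1$ if node $i$ is measured and $\delta_i=0$ otherwise. The networked system consists of $N$ nodes $\dot x_i=Ax_i+\sum_{j=1}^N w_{ij}Hx_j$, $y_i=Cx_i$, with stacked state $X=[x_1^T,\dots,x_N^T]^T\in\mathbb R^{Nn}$. A topological change replaces $L$ by another real $N\times N$ weight matrix $\bar L$ with zero diagonal (edges removed or added, or edge weights changed), giving the new system $\dot{\bar X}=\bar\Phi\bar X$, $\bar Y=\Psi\bar X$. $\otimes$ is the Kronecker product. Discernibility. A pair of initial states $(X_0,\bar X_0)\in\mathbb R^{Nn}\times\mathbb R^{Nn}$ is called $\Psi$-indiscernible with respect to $L\to\bar L$ if $\Psi e^{\Phi t}X_0=\Psi e^{\bar\Phi t}\bar X_0$ for all $t\ge 0$. The change $L\to\bar L$ is called $\Psi$-discernible if the only $\Psi$-indiscernible pair is the trivial one $(\mathbf 0_{Nn},\mathbf 0_{Nn})$; otherwise it is $\Psi$-indiscernible. Generalized Jordan chains. For $M,H\in\mathbb C^{n\times n}$ and an eigenvalue $\lambda$ of $M$, nonzero $x_1$ and vectors $x_2,\dots,x_\theta$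 form a generalized Jordan chain of $M$ about $H$ corresponding to $\lambda$, with top vector $x_1$, if $(\lambda I-M)x_1=0$ and $(\lambda I-M)x_{i+1}=Hx_i$ for $i=1,\dots,\theta-1$; the maximum number $\theta$ (possibly infinite) is the length of the chain. The spaces $V_{ij}$. Let $\lambda_1,\dots,\lambda_s$ be the eigenvalues of $L$ counted with geometric multiplicity (one for each Jordan block), and let $t_i^1,\dots,t_i^{\alpha_i}$ be the Jordan chain of $L$ associated with $\lambda_i$ ($t_i^1$ the top vector, an eigenvector, and $(L-\lambda_iI)t_i^{k+1}=t_i^k$), of length $\alpha_i$; together these chains form a Jordan basis. For each $i$ let $\mu_i^1,\dots,\mu_i^{p_i}$ be the eigenvalues of $A+\lambda_iH$ counted with geometric multiplicity, and let $\xi_{ij}^1,\dots,\xi_{ij}^{\theta_{ij}}$ be the corresponding generalized Jordan chain of $A+\lambda_iH$ about $H$ with top vector $\xi_{ij}^1$ and length $\theta_{ij}$. Put $\gamma_{ij}=\min\{\alpha_i,\theta_{ij}\}$, $\eta_{ij}^k=\sum_{l=1}^{k}t_i^{k+1-l}\otimes\xi_{ij}^{l}$ for $k=1,\dots,\gamma_{ij}$ (so $\eta_{ij}^1=t_i^1\otimes\xi_{ij}^1$, $\eta_{ij}^2=t_i^2\otimes\xi_{ij}^1+t_i^1\otimes\xi_{ij}^2$, etc.), and $V_{ij}=\mathrm{span}_{\mathbb C}\{\eta_{ij}^1,\dots,\eta_{ij}^{\gamma_{ij}}\}$. Let $\Gamma(\mu)=\{(i,j): \mu_i^j=\mu,\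 1\le j\le p_i,\ 1\le i\le s\}$. The chains are understood to be chosen so that $\{x\in\mathbb C^{Nn}:\Phi x=\mu x\}=\bigoplus_{(i,j)\in\Gamma(\mu)}V_{ij}$ for every $\mu$ (a known result the paper quotes from earlier work). The objects $\bar\lambda_i,\bar s,\bar\mu_i^j,\bar p_i,\bar\gamma_{ij},\bar\eta_{ij}^k,\bar V_{ij},\bar\Gamma(\mu)$ are defined in the same way with $L,\Phi$ replaced by $\bar L,\bar\Phi$, so that likewise $\{x\in\mathbb C^{Nn}:\bar\Phi x=\mu x\}=\bigoplus_{(i,j)\in\bar\Gamma(\mu)}\bar V_{ij}$. An empty direct sum is $\{\mathbf 0_{Nn}\}$. Notation. $\sigma(\cdot)$ is the set of complex eigenvalues; $\mathcal N(\cdot)$ is the null space, taken in $\mathbb C^{Nn}$; $\oplus$ is the internal direct sum of subspaces (condition (1) ensures that the outer sum in (2) is direct). *)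

(* Defs.v *)
(* MathComp-Analysis; [complex] and [mxtens] are from mathcomp-real-closed. *)
From mathcomp Require Import all_boot all_order all_algebra.
From mathcomp Require Import complex mxtens.
From mathcomp Require Import boolp classical_sets reals topology normedtype
  sequences.

Set Implicit Arguments.
Unset Strict Implicit.
Unset Printing Implicit Defensive.

Import Order.TTheory GRing.Theory Num.Theory.
Import numFieldNormedType.Exports.

Local Open Scope ring_scope.

Definition network_state (K : comNzRingType) (N n : nat) (A H : 'M[K]_n)
    (L : 'M[K]_N) : 'M[K]_(N * n) :=
  (1%:M : 'M[K]_N) *t A + L *t H.

(* diag(delta_1, ..., delta_N), with S the set of measured nodes. *)
Definition measurement (K : comNzRingType) (N : nat) (S : {set 'I_N}) : 'M[K]_N :=
  diag_mx (\row_i (i \in S)%:R).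

Definition network_output (K : comNzRingType) (N n p : nat) (S : {set 'I_N})
    (C : 'M[K]_(p, n)) : 'M[K]_(N * p, N * n) :=
  measurement K S *t C.

Definition expmx (R : realType) (m : nat) (M : 'M[R]_m) : 'M[R]_m :=
  limn (series (fun k : nat => k`!%:R^-1 *: M ^+ k)).

Definition indiscernible_pair (R : realType) (m q : nat) (Psi : 'M[R]_(q, m))
    (Phi Phibar : 'M[R]_m) (X0 X0bar : 'cV[R]_m) : Prop :=
  forall t : R, 0 <= t ->
    Psi *m expmx (t *: Phi) *m X0 = Psi *m expmx (t *: Phibar) *m X0bar.

Definition discernible (R : realType) (m q : nat) (Psi : 'M[R]_(q, m))
    (Phi Phibar : 'M[R]_m) : Prop :=
  forall X0 X0bar : 'cV[R]_m,
    indiscernible_pair Psi Phi Phibar X0 X0bar -> X0 = 0 /\ X0bar = 0.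

(* M acting on column vectors; the library's [eigenvalue], [eigenspace] and
   [kermx] for matrices are about row vectors. *)
Definition colfun (K : fieldType) (q m : nat) (M : 'M[K]_(q, m)) :
    'Hom('cV[K]_m, 'cV[K]_q) :=
  linfun (mulmx M).

(* Chains are functions on nat indexed from 1, the top vector being the value
   at 1; only the values at 1, ..., length are meaningful. *)

Definition jordan_chain (K : fieldType) (m : nat) (M : 'M[K]_m) (lam : K)
    (len : nat) (x : nat -> 'cV[K]_m) : Prop :=
  [/\ (0 < len)%N, x 1 != 0, M *m x 1 = lam *: x 1 &
      forall k, (0 < k < len)%N -> (M - lam%:M) *m x k.+1 = x k].

Definition gen_jordan_chain (K : fieldType) (m : nat) (M H : 'M[K]_m) (lam : K)
    (len : nat) (x : nat -> 'cV[K]_m) : Prop :=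
  [/\ (0 < len)%N, x 1 != 0, (lam%:M - M) *m x 1 = 0 &
      forall k, (0 < k < len)%N -> (lam%:M - M) *m x k.+1 = H *m x k].

(* x is a generalized Jordan chain whose length is the largest one possible for
   its top vector; [None] stands for an infinite length. *)
Definition max_gen_jordan_chain (K : fieldType) (m : nat) (M H : 'M[K]_m)
    (lam : K) (len : option nat) (x : nat -> 'cV[K]_m) : Prop :=
  match len with
  | Some l => gen_jordan_chain M H lam l x /\
      (forall l' y, y 1 = x 1 -> gen_jordan_chain M H lam l' y -> (l' <= l)%N)
  | None => forall l, (0 < l)%N -> gen_jordan_chain M H lam l x
  end.

(* Chain [ct i], of length [calpha i], is the i-th Jordan chain of L, for the
   eigenvalue [clam i].  A + clam i *: H has [cp i] eigenvalues counted with
   geometric multiplicity; for ij = (i, j), [cmu ij] is the j-th of them and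
   [cxi ij] is the generalized Jordan chain, of length [ctheta ij], attached to
   it.  The first component of ij is [tag ij]. *)
Record chain_data (K : fieldType) (N n : nat) := ChainData {
  cs : nat;
  clam : 'I_cs -> K;
  calpha : 'I_cs -> nat;
  ct : 'I_cs -> nat -> 'cV[K]_N;
  cp : 'I_cs -> nat;
  cmu : {i : 'I_cs & 'I_(cp i)} -> K;
  ctheta : {i : 'I_cs & 'I_(cp i)} -> option nat;
  cxi : {i : 'I_cs & 'I_(cp i)} -> nat -> 'cV[K]_n }.

Definition cidx (K : fieldType) (N n : nat) (D : chain_data K N n) : finType :=
  {i : 'I_(cs D) & 'I_(cp i)}.

Definition cgamma (K : fieldType) (N n : nat) (D : chain_data K N n)
    (ij : cidx D) : nat :=
  if ctheta ij is Some l then minn (calpha (tag ij)) l else calpha (tag ij).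

Definition ceta (K : fieldType) (N n : nat) (D : chain_data K N n)
    (ij : cidx D) (k : nat) : 'cV[K]_(N * n) :=
  \sum_(1 <= l < k.+1) (ct (tag ij) (k.+1 - l)%N *t cxi ij l : 'cV[K]_(N * n)).

Definition cV (K : fieldType) (N n : nat) (D : chain_data K N n)
    (ij : cidx D) : {vspace 'cV[K]_(N * n)} :=
  <<[seq ceta ij k | k <- iota 1 (cgamma ij)]>>%VS.

Definition cGamma (K : fieldType) (N n : nat) (D : chain_data K N n)
    (mu : K) : {set cidx D} :=
  [set ij | cmu ij == mu].

Record is_chain_data (K : fieldType) (N n : nat) (A H : 'M[K]_n) (L : 'M[K]_N)
    (D : chain_data K N n) : Prop := IsChainData {
  ct_chain : forall i, jordan_chain L (clam i) (calpha i) (@ct _ _ _ D i);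
  ct_basis : basis_of fullv
    [seq @ct _ _ _ D i k | i <- enum 'I_(cs D), k <- iota 1 (calpha i)];
  cxi_chain : forall ij : cidx D,
    max_gen_jordan_chain (A + clam (tag ij) *: H) H (cmu ij) (ctheta ij)
      (cxi ij);
  (* The eigenvalues of A + lam_i H are counted with geometric multiplicity:
     the top vectors with a given eigenvalue form a basis of its eigenspace. *)
  cxi_basis : forall (i : 'I_(cs D)) (mu : K),
    basis_of (passmx.leigenspace (colfun (A + clam i *: H)) mu)
      [seq cxi ij 1 | ij <- enum (cidx D) & (tag ij == i) && (cmu ij == mu)];
  (* The last two conditions are not automatic: they restrict the choice of the
     top vectors (a basis adapted to the filtration of the eigenspace by chain
     length works). *)
  cV_direct : forall mu : K, directv (\sum_(ij in cGamma D mu) cV ij)%VS;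
  cV_eigenspace : forall mu : K,
    passmx.leigenspace (colfun (network_state A H L)) mu
      = (\sum_(ij in cGamma D mu) cV ij)%VS }.

Definition toC (R : realType) (q m : nat) (M : 'M[R]_(q, m)) :
    'M[complex R]_(q, m) :=
  map_mx (real_complex R) M.

(* Main.v *)
From HB Require Import structures.
Require Import Defs.
From mathcomp Require Import all_boot all_order all_algebra.
From mathcomp Require Import complex mxtens.
From mathcomp Require Import boolp classical_sets reals topology normedtype
  sequences.

Set Implicit Arguments.
Unset Strict Implicit.
Unset Printing Implicit Defensive.

Import Order.TTheory GRing.Theory Num.Theory.
Import numFieldNormedType.Exports.

Local Open Scope ring_scope.

(** Two outputs Psi e^(Phi t) X0 and Psi e^(Phibar t) X0bar agree for all t
    exactly when all their Taylor coefficients at 0 agree, that is when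
    Psi Phi^k X0 = Psi Phibar^k X0bar for every k ([indiscernible_pairP]).  So
    discernibility is Kalman observability of the doubled system with state
    matrix diag(Phi, Phibar), state (X0, X0bar) and output matrix (Psi, -Psi)
    ([discernible_observable]).

    Observability of a real pair is insensitive to passing to the complex
    numbers, because the powers of a real matrix act separately on the real and
    imaginary parts ([observable_toC]).  Over an algebraically closed field the
    unobservable states form a subspace stable under the state matrix, hence
    containing an eigenvector if nonzero: this is the Popov-Belevitch-Hautus
    test ([hautus_test]).  An eigenvector of diag(Phi, Phibar) for mu is a pair
    (v, w) <> 0 with Phi v = mu v and Phibar w = mu w, and it is unobservable
    when Psi v = Psi w ([discernible_eigenpairs]).

    With E and Ebar the eigenspaces of Phi and Phibar for mu, such pairs are
    absent exactly when E meets Ebar, and the kernel of Psi meets E + Ebar, in 0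
    only ([eigenspace_conditionsP]).  Indeed, if Psi v = Psi w, then v - w lies
    in the kernel of Psi and in E + Ebar, so v = w, which lies in E and in Ebar,
    so v = w = 0.  Conversely x in E and in Ebar gives the pair (x, x), and
    v + w in the kernel gives (v, -w).  The chains enter only through the
    description of E and Ebar as the sums of the spaces V_ij. *)

(** * Observability and eigenvectors *)

(** The vectors G F^k x are the derivatives at t = 0 of the output G e^(F t) x of
    the system with initial state x; phrased with them, observability makes
    sense over any ring. *)
Definition observable (K : comNzRingType) (m q : nat) (F : 'M[K]_m)
    (G : 'M[K]_(q, m)) : Prop :=
  forall x : 'cV[K]_m, (forall k, G *m F ^+ k *m x = 0) -> x = 0.

(** The characteristic polynomial of F splits and kills x.  Applying its factors
    F - z to x one at a time, the last nonzero vector met is an eigenvector, and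
    P survives each application. *)
Lemma eigenvector_of_stable (K : closedFieldType) (m : nat) (F : 'M[K]_m)
    (P : 'cV[K]_m -> Prop) (x : 'cV[K]_m)
    (P_stable : forall a y, P y -> P (F *m y - a *: y)) :
  x != 0 -> P x -> exists a v, [/\ v != 0, F *m v = a *: v & P v].
Proof.
case: m F P x P_stable => [|m] F P x P_stable.
  by move=> x0; rewrite flatmx0 eqxx in x0.
have [r char_F] := closed_field_poly_normal (char_poly F).
have: horner_mx F (\prod_(z <- r) ('X - z%:P)) *m x = 0.
  have := Cayley_Hamilton F.
  rewrite char_F (monicP (char_poly_monic F)) scale1r => ->.
  by rewrite mul0mx.
elim: r x {char_F} => [|z r IHr] x.
  by rewrite big_nil rmorph1 mul1mx => ->; rewrite eqxx.
rewrite big_cons mulrC rmorphM /= rmorphB /= horner_mx_X horner_mx_C.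
rewrite -mulmxE -mulmxA mulmxBl mul_scalar_mx => r_kills x0 Px.
have [Fx|Fx0] := eqVneq (F *m x - z *: x) 0.
  by exists z, x; split=> //; apply/eqP; rewrite -subr_eq0 Fx.
exact: IHr r_kills Fx0 (P_stable z x Px).
Qed.

(** Having zero output is a property stable under F, so a nonzero state with
    zero output yields an eigenvector of F in the kernel of G. *)
Lemma hautus_test (K : closedFieldType) (m q : nat) (F : 'M[K]_m)
    (G : 'M[K]_(q, m)) :
  observable F G <->
  forall a (v : 'cV[K]_m), F *m v = a *: v -> G *m v = 0 -> v = 0.
Proof.
split=> [obs a v Fv Gv|test x Gx].
  apply: obs => k; suff -> : G *m F ^+ k *m v = a ^+ k *: (G *m v).
    by rewrite Gv scaler0.
  elim: k => [|k IHk]; first by rewrite mulmx1 scale1r.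
  by rewrite exprSr -mulmxE mulmxA -mulmxA Fv -scalemxAr IHk scalerA -exprS.
apply/eqP/negP => /negP x0.
have stab a (y : 'cV[K]_m) : (forall k, G *m F ^+ k *m y = 0) ->
    forall k, G *m F ^+ k *m (F *m y - a *: y) = 0.
  move=> Gy k; rewrite mulmxBr -scalemxAr Gy scaler0 subr0.
  by rewrite mulmxA -(mulmxA G) mulmxE -exprSr Gy.
have [a [v [v0 Fv Gv]]] := eigenvector_of_stable
  (P := fun y => forall k, G *m F ^+ k *m y = 0) stab x0 Gx.
have := Gv 0; rewrite expr0 mulmx1 => /(test a v Fv) v_0.
by rewrite v_0 eqxx in v0.
Qed.

(** * Real and complex observability *)

Section RealAndComplex.
Variable R : realType.

Lemma toC_mul (q m r : nat) (M : 'M[R]_(q, m)) (M' : 'M[R]_(m, r)) :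
  toC (M *m M') = toC M *m toC M'.
Proof. exact: map_mxM. Qed.

Lemma toC_exp (m : nat) (M : 'M[R]_m) k : toC (M ^+ k) = toC M ^+ k.
Proof.
elim: k => [|k IHk]; first by rewrite !expr0; exact: map_mx1.
by rewrite !exprS -!mulmxE toC_mul IHk.
Qed.

Lemma Re_toC_mul (q m : nat) (M : 'M[R]_(q, m)) (x : 'cV[complex R]_m) :
  map_mx (@complex.Re R) (toC M *m x) = M *m map_mx (@complex.Re R) x.
Proof.
apply/matrixP => i j; rewrite !mxE raddf_sum; apply: eq_bigr => k _.
by rewrite !mxE; case: (x k j) => a b /=; rewrite mul0r subr0.
Qed.

Lemma Im_toC_mul (q m : nat) (M : 'M[R]_(q, m)) (x : 'cV[complex R]_m) :
  map_mx (@complex.Im R) (toC M *m x) = M *m map_mx (@complex.Im R) x.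
Proof.
apply/matrixP => i j; rewrite !mxE raddf_sum; apply: eq_bigr => k _.
by rewrite !mxE; case: (x k j) => a b /=; rewrite mul0r addr0.
Qed.

(** From right to left: both the real and the imaginary part of an unobservable
    complex state are unobservable real states. *)
Lemma observable_toC (m q : nat) (F : 'M[R]_m) (G : 'M[R]_(q, m)) :
  observable (toC F) (toC G) <-> observable F G.
Proof.
split=> obs x Gx.
  apply: (map_mx_inj (f := real_complex R)).
  rewrite map_mx0; apply: obs => k.
  by rewrite -toC_exp -!toC_mul Gx; exact: map_mx0.
have Re_x : map_mx (@complex.Re R) x = 0.
  apply: obs => k; rewrite -Re_toC_mul toC_mul toC_exp Gx.
  by apply/matrixP => i j; rewrite !mxE.
have Im_x : map_mx (@complex.Im R) x = 0.
  apply: obs => k; rewrite -Im_toC_mul toC_mul toC_exp Gx.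
  by apply/matrixP => i j; rewrite !mxE.
apply/matrixP => i j.
move/matrixP/(_ i j): Re_x; move/matrixP/(_ i j): Im_x; rewrite !mxE.
by case: (x i j) => a b /= -> ->.
Qed.

End RealAndComplex.

(** * Power series and the matrix exponential *)

Lemma exp_scalemx (K : comNzRingType) (m : nat) (a : K) (M : 'M[K]_m) k :
  (a *: M) ^+ k = a ^+ k *: M ^+ k.
Proof.
elim: k => [|k IHk]; first by rewrite !expr0 scale1r.
by rewrite !exprS IHk -!mulmxE -scalemxAr -scalemxAl scalerA mulrC.
Qed.

Section Analysis.
Local Open Scope classical_set_scope.
Variable R : realType.

Lemma sum_exp_half_le2 (t : R) n :
  0 <= t -> t <= 2^-1 -> \sum_(0 <= k < n) t ^+ k <= 2.
Proof.
move=> t0 t2; elim: n => [|n IHn]; first by rewrite big_geq.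
rewrite big_nat_recl // expr0; under eq_bigr do rewrite exprS.
rewrite -mulr_sumr -[2](_ : 1 + 2^-1 * 2 = 2); last by rewrite mulVf ?pnatr_eq0.
by rewrite lerD2l ler_pM // sumr_ge0 // => k _; rewrite exprn_ge0.
Qed.

(** The coefficients are bounded by some K, as the series converges at t = 1.
    Hence for 0 < t <= 1/2 all the terms but c 0 add up to at most 2 K t, which
    is as small as desired, while the whole series sums to 0. *)
Lemma pseries_eq0_head (V : normedModType R) (c : nat -> V) :
  (forall t : R, 0 < t -> series (fun k => t ^+ k *: c k) @ \oo --> (0 : V)) ->
  c 0 = 0.
Proof.
move=> c_sum.
have [K K0 cK] : exists2 K : R, 0 < K & forall k, `|c k| <= K.
  have c_series : series c @ \oo --> (0 : V).
    by have := c_sum 1 ltr01; under eq_fun do rewrite expr1n scale1r.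
  have /pinfty_ex_gt0[K K0 cK] : bounded_fun c.
    apply: cvg_seq_bounded; apply/cvg_ex; exists 0.
    by apply: cvg_series_cvg_0; apply/cvg_ex; exists 0.
  by exists K => // k; apply: cK.
apply/eqP; rewrite -normr_le0; apply/ler_addgt0Pl => e e0; rewrite addr0.
pose t : R := Num.min 2^-1 (e / (K * 2)).
have t0 : 0 < t by rewrite lt_min invr_gt0 ltr0n /= divr_gt0 // mulr_gt0.
have tail n : `|c 0 - series (fun k => t ^+ k *: c k) n.+1| <= e.
  rewrite seriesEnat /= big_nat_recl // expr0 scale1r opprD addrA subrr add0r.
  rewrite normrN (le_trans (ler_norm_sum _ _ _)) //.
  apply: (@le_trans _ _ (t * K * \sum_(0 <= k < n) t ^+ k)).
    rewrite mulr_sumr ler_sum // => k _.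
    rewrite normrZ normrX (gtr0_norm t0) exprS mulrAC.
    by rewrite ler_pM2r ?exprn_gt0 // ler_pM2l.
  have : t * (K * 2) <= e by rewrite -ler_pdivlMr ?mulr_gt0 // ge_min lexx orbT.
  apply: le_trans; rewrite mulrA ler_pM2l ?mulr_gt0 //.
  by rewrite sum_exp_half_le2 ?(ltW t0) // ge_min lexx.
have cvg_tail :
    `|c 0 - series (fun k => t ^+ k *: c k) n.+1| @[n --> \oo] --> `|c 0|.
  rewrite -[in `|c 0|](subr0 (c 0)); apply: cvg_norm.
  apply: cvgB; first exact: cvg_cst.
  by rewrite cvg_shiftS; apply: c_sum.
rewrite -(cvg_lim _ cvg_tail) //.
apply: limr_le; first by apply/cvg_ex; exists `|c 0|.
by near=> n; apply: tail.
Unshelve. all: by end_near. Qed.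

(** A power series is determined by its sums on t > 0: once c 0 = 0, dividing by
    t gives a series of the same kind whose coefficients are shifted by one. *)
Lemma pseries_eq0 (V : normedModType R) (c : nat -> V) :
  (forall t : R, 0 < t -> series (fun k => t ^+ k *: c k) @ \oo --> (0 : V)) ->
  forall k, c k = 0.
Proof.
move=> c_sum k; elim: k c c_sum => [|k IHk] c c_sum.
  exact: pseries_eq0_head.
apply: (IHk (fun k => c k.+1)) => t t0.
have -> : series (fun k => t ^+ k *: c k.+1) =
          (fun n => t^-1 *: series (fun k => t ^+ k *: c k) n.+1).
  apply/funext => n; rewrite !seriesEnat /= big_nat_recl //.
  rewrite (pseries_eq0_head c_sum) scaler0 add0r scaler_sumr.
  by apply: eq_bigr => i _; rewrite scalerA exprS mulKf ?gt_eqF.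
rewrite -[0 in X in _ --> X](scaler0 _ t^-1); apply: cvgZr.
by rewrite cvg_shiftS; apply: c_sum.
Qed.

(** The norm of a matrix is the largest absolute value of its entries, and an
    entry of the product is a sum of m products of entries. *)
Lemma norm_mulmx (q m r : nat) (M : 'M[R]_(q, m)) (M' : 'M[R]_(m, r)) :
  `|M *m M'| <= m%:R * `|M| * `|M'|.
Proof.
have entry a b (B : 'M[R]_(a, b)) i j : `|B i j| <= `|B|.
  rewrite [leRHS]/Num.norm /= mx_normrE.
  exact: (le_bigmax _ (fun ij => `|B ij.1 ij.2|) (i, j)).
rewrite [leLHS]/Num.norm /= mx_normrE; apply: bigmax_le.
  by rewrite !mulr_ge0.
move=> -[i j] _ /=; rewrite mxE (le_trans (ler_norm_sum _ _ _)) //.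
apply: (@le_trans _ _ (\sum_(k < m) `|M| * `|M'|)).
  by apply: ler_sum => k _; rewrite normrM ler_pM.
by rewrite sumr_const card_ord -mulrA mulr_natl.
Qed.

Lemma continuous_mulmx (q m r : nat) (P : 'M[R]_(q, m)) :
  continuous (mulmx P : 'M[R]_(m, r) -> 'M[R]_(q, r)).
Proof.
apply: bounded_linear_continuous; apply/linear_boundedP.
near=> K => B; rewrite (le_trans (norm_mulmx _ _)) // ler_wpM2r //.
by near: K; apply: nbhs_pinfty_ge; exact: num_real.
Unshelve. all: by end_near. Qed.

Lemma continuous_mulmxr (q m r : nat) (P : 'M[R]_(m, r)) :
  continuous (mulmxr P : 'M[R]_(q, m) -> 'M[R]_(q, r)).
Proof.
apply: bounded_linear_continuous; apply/linear_boundedP.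
near=> K => B; rewrite /= (le_trans (norm_mulmx _ _)) // mulrAC ler_wpM2r //.
by near: K; apply: nbhs_pinfty_ge; exact: num_real.
Unshelve. all: by end_near. Qed.

Lemma norm_mx_exp (m : nat) (M : 'M[R]_m) k :
  `|M ^+ k| <= (m%:R * `|M|) ^+ k.
Proof.
elim: k => [|k IHk].
  rewrite !expr0 [leLHS]/Num.norm /= mx_normrE bigmax_le // => -[i j] _ /=.
  by rewrite mxE; case: (i == j); rewrite ?normr1 ?normr0.
rewrite !exprS -mulmxE (le_trans (norm_mulmx _ _)) // ler_wpM2l //.
by rewrite mulr_ge0.
Qed.

(* Joins the complete uniform structure of matrices with their norm, so that
   absolutely convergent series of matrices converge. *)
HB.instance Definition _ (m n : nat) := NormedModule.on 'M[R]_(m, n).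

(** The series converges absolutely, its terms being dominated in norm by
    those of the scalar exponential series of m |M|. *)
Lemma cvg_expmx (m : nat) (M : 'M[R]_m) :
  series (fun k : nat => k`!%:R^-1 *: M ^+ k) @ \oo --> expmx M.
Proof.
rewrite /expmx; apply: (@normed_cvg R 'M[R]_m).
apply: (series_le_cvg _ _ _ (is_cvg_series_exp_coeff (m%:R * `|M|))).
- by move=> n /=.
- by move=> n; rewrite exp_coeff_ge0 // mulr_ge0.
move=> n /=; rewrite normrZ ger0_norm ?invr_ge0 // mulrC.
rewrite ler_pM2r ?invr_gt0 ?ltr0n ?fact_gt0 //.
exact: norm_mx_exp.
Qed.

Arguments cvg_expmx {m} M.

Lemma cvg_mulmx_expmx (m q : nat) (P : 'M[R]_(q, m)) (M : 'M[R]_m)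
    (x : 'cV[R]_m) (t : R) :
  series (fun k : nat => t ^+ k *: (k`!%:R^-1 *: (P *m M ^+ k *m x))) @ \oo
    --> P *m expmx (t *: M) *m x.
Proof.
pose f (B : 'M[R]_m) := P *m B *m x.
have -> : series (fun k : nat => t ^+ k *: (k`!%:R^-1 *: (P *m M ^+ k *m x))) =
  f \o series (fun k : nat => k`!%:R^-1 *: (t *: M) ^+ k).
  apply/funext => n; rewrite /f /= !seriesEnat /= mulmx_sumr mulmx_suml.
  apply: eq_bigr => k _; rewrite exp_scalemx -!scalemxAr -!scalemxAl.
  by rewrite !scalerA mulrC.
have f_cont : continuous f.
  move=> B; apply: (@continuous_comp _ _ _ (mulmx P) (mulmxr x)).
    exact: continuous_mulmx.
  exact: continuous_mulmxr.
exact: (cvg_comp _ _ (cvg_expmx (t *: M)) (f_cont _)).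
Qed.

Arguments cvg_mulmx_expmx {m q} P M x t.

(** Both outputs are sums of power series in t, whose coefficients are the
    Psi Phi^k X0 / k! and Psi Phibar^k X0bar / k!. *)
Lemma indiscernible_pairP (m q : nat) (Psi : 'M[R]_(q, m))
    (Phi Phibar : 'M[R]_m) (X0 X0bar : 'cV[R]_m) :
  indiscernible_pair Psi Phi Phibar X0 X0bar <->
  forall k, Psi *m Phi ^+ k *m X0 = Psi *m Phibar ^+ k *m X0bar.
Proof.
split=> [ind|coef t _].
  pose c k :=
    k`!%:R^-1 *: (Psi *m Phi ^+ k *m X0 - Psi *m Phibar ^+ k *m X0bar).
  suff c0 k : c k = 0.
    move=> k; apply/eqP; rewrite -subr_eq0.
    have /eqP := c0 k; rewrite /c scaler_eq0 invr_eq0 pnatr_eq0.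
    by rewrite gtn_eqF ?fact_gt0.
  apply: (pseries_eq0 (V := 'cV[R]_q)) => t t0.
  pose u M (x : 'cV[R]_m) k := t ^+ k *: (k`!%:R^-1 *: (Psi *m M ^+ k *m x)).
  have -> : series (fun k => t ^+ k *: c k) =
            (fun n => series (u Phi X0) n - series (u Phibar X0bar) n).
    apply/funext => n; rewrite !seriesEnat /= -sumrB.
    by apply: eq_bigr => i _; rewrite /c !scalerBr.
  rewrite -(subrr (Psi *m expmx (t *: Phi) *m X0)) {2}(ind t (ltW t0)).
  by apply: cvgB; apply: cvg_mulmx_expmx.
have := cvg_mulmx_expmx Psi Phibar X0bar t.
under eq_fun do rewrite -coef.
move=> lim_bar; apply: cvg_unique (cvg_mulmx_expmx Psi Phi X0 t) lim_bar.
exact: norm_hausdorff.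
Qed.

End Analysis.

(** * Discernibility in terms of eigenspaces *)

Lemma exp_block_diag (K : comNzRingType) (m1 m2 : nat) (M1 : 'M[K]_m1)
    (M2 : 'M[K]_m2) k :
  block_mx M1 0 0 M2 ^+ k = block_mx (M1 ^+ k) 0 0 (M2 ^+ k).
Proof.
elim: k => [|k IHk]; first by rewrite !expr0 -scalar_mx_block.
by rewrite !exprS IHk -!mulmxE mulmx_block !(mul0mx, mulmx0, addr0, add0r).
Qed.

Lemma discernible_observable (R : realType) (m q : nat) (Psi : 'M[R]_(q, m))
    (Phi Phibar : 'M[R]_m) :
  discernible Psi Phi Phibar <->
  observable (block_mx Phi 0 0 Phibar) (row_mx Psi (- Psi)).
Proof.
have output k (x y : 'cV[R]_m) :
    row_mx Psi (- Psi) *m block_mx Phi 0 0 Phibar ^+ k *m col_mx x y =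
    Psi *m Phi ^+ k *m x - Psi *m Phibar ^+ k *m y.
  rewrite exp_block_diag mul_row_block !mulmx0 addr0 add0r mul_row_col.
  by rewrite !mulNmx.
split=> [disc x|obs X0 X0bar /indiscernible_pairP ind].
  rewrite -[x]vsubmxK => out0.
  have [|-> ->] := disc (usubmx x) (dsubmx x); last exact: col_mx0.
  apply/indiscernible_pairP => k; apply/eqP; rewrite -subr_eq0 -output.
  by rewrite out0.
have /eqP : col_mx X0 X0bar = 0 by apply: obs => k; rewrite output ind subrr.
by rewrite col_mx_eq0 => /andP[/eqP-> /eqP->].
Qed.

Lemma mem_leigenspace_colfun (K : fieldType) (m : nat) (M : 'M[K]_m) (mu : K)
    (v : 'cV[K]_m) :
  (v \in passmx.leigenspace (colfun M) mu) = (M *m v == mu *: v).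
Proof.
by rewrite memv_ker !lfunE /= !lfunE /= subr_eq0 scale_lfunE id_lfunE.
Qed.

Lemma toC_network_state (R : realType) (N n : nat) (A H : 'M[R]_n)
    (L : 'M[R]_N) :
  toC (network_state A H L) = network_state (toC A) (toC H) (toC L).
Proof. by rewrite /network_state /toC map_mxD !map_mxT map_mx1. Qed.

(** A pair (v, w) with equal outputs corresponds to the element v - w of
    E + Ebar in the kernel; the trivial intersection of E and Ebar is what
    recovers v = w = 0 from v - w = 0. *)
Lemma eigenspace_conditionsP (K : fieldType) (m q : nat) (Psi : 'M[K]_(q, m))
    (E Ebar : {vspace 'cV[K]_m}) :
  (E :&: Ebar = 0 /\ lker (colfun Psi) :&: (E + Ebar) = 0)%VS <->
  forall v w, v \in E -> w \in Ebar -> Psi *m v = Psi *m w -> v = 0 /\ w = 0.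
Proof.
split=> [[cap0 ker0] v w vE wE Pvw|inj].
  have : v - w \in (lker (colfun Psi) :&: (E + Ebar))%VS.
    rewrite memv_cap memv_ker lfunE /= mulmxBr Pvw subrr eqxx /=.
    by rewrite memv_add // rpredN.
  rewrite ker0 memv0 subr_eq0 => /eqP vw.
  have : v \in (E :&: Ebar)%VS by rewrite memv_cap vE vw wE.
  by rewrite cap0 memv0 -vw => /eqP ->.
split; apply/eqP; rewrite -subv0; apply/subvP => x; rewrite memv_cap memv0.
  by move=> /andP[xE xEbar]; have [-> _] := inj x x xE xEbar erefl.
move=> /andP[+ /memv_addP[v vE [w wE x_eq]]].
rewrite memv_ker lfunE /= x_eq mulmxDr addr_eq0 -mulmxN => /eqP Pvw.
have wE' : - w \in Ebar by rewrite rpredN.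
have [-> /eqP] := inj v (- w) vE wE' Pvw.
by rewrite oppr_eq0 => /eqP ->; rewrite addr0.
Qed.

Lemma discernible_eigenpairs (R : realType) (m q : nat) (Psi : 'M[R]_(q, m))
    (Phi Phibar : 'M[R]_m) :
  discernible Psi Phi Phibar <->
  forall mu (v w : 'cV[complex R]_m),
    toC Phi *m v = mu *: v -> toC Phibar *m w = mu *: w ->
    toC Psi *m v = toC Psi *m w -> v = 0 /\ w = 0.
Proof.
rewrite discernible_observable -observable_toC hautus_test.
rewrite /toC map_block_mx !map_mx0 map_row_mx map_mxN.
split=> test mu v => [w Phi_v Phi_w Psi_vw|].
  suff /eqP : col_mx v w = 0 by rewrite col_mx_eq0 => /andP[/eqP-> /eqP->].
  apply: (test mu).
    by rewrite mul_block_col !mul0mx addr0 add0r Phi_v Phi_w scale_col_mx.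
  by rewrite mul_row_col mulNmx Psi_vw subrr.
rewrite -[v]vsubmxK mul_block_col !mul0mx addr0 add0r scale_col_mx.
move=> /eq_col_mx[Phi_v Phi_w]; rewrite mul_row_col mulNmx => /eqP.
rewrite subr_eq0 => /eqP Psi_vw.
by have [-> ->] := test mu _ _ Phi_v Phi_w Psi_vw; exact: col_mx0.
Qed.

Theorem theorem2 (R : realType) (N n p : nat) (A H : 'M[R]_n)
    (C : 'M[R]_(p, n)) (S : {set 'I_N}) (L Lbar : 'M[R]_N)
    (D Dbar : chain_data (complex R) N n)
    (hN : (2 <= N)%N)
    (hL : forall i : 'I_N, L i i = 0)
    (hLbar : forall i : 'I_N, Lbar i i = 0)
    (hD : is_chain_data (toC A) (toC H) (toC L) D)
    (hDbar : is_chain_data (toC A) (toC H) (toC Lbar) Dbar) :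
  let Phi := network_state A H L in
  let Phibar := network_state A H Lbar in
  let Psi := network_output S C in
  discernible Psi Phi Phibar <->
  forall mu : complex R,
    passmx.leigenvalue (colfun (toC Phi)) mu \/ passmx.leigenvalue (colfun (toC Phibar)) mu ->
    ((\sum_(ij in cGamma D mu) cV ij) :&:
       (\sum_(ij in cGamma Dbar mu) cV ij) = 0)%VS /\
    (lker (colfun (toC Psi)) :&:
       ((\sum_(ij in cGamma D mu) cV ij) +
        (\sum_(ij in cGamma Dbar mu) cV ij)) = 0)%VS.
Proof.
move=> Phi Phibar Psi.
have E mu : passmx.leigenspace (colfun (toC Phi)) mu =
    (\sum_(ij in cGamma D mu) cV ij)%VS.
  by rewrite toC_network_state; exact: cV_eigenspace hD mu.
have Ebar mu : passmx.leigenspace (colfun (toC Phibar)) mu =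
    (\sum_(ij in cGamma Dbar mu) cV ij)%VS.
  by rewrite toC_network_state; exact: cV_eigenspace hDbar mu.
rewrite discernible_eigenpairs; split=> [pairs mu _|conds mu v w].
  rewrite -E -Ebar eigenspace_conditionsP => v w.
  by rewrite !mem_leigenspace_colfun => /eqP + /eqP +; exact: pairs.
move=> /eqP + /eqP +; rewrite -!mem_leigenspace_colfun => Phi_v Phi_w.
have [/orP spec|] := boolP (passmx.leigenvalue (colfun (toC Phi)) mu ||
                             passmx.leigenvalue (colfun (toC Phibar)) mu).
  have := conds mu spec; rewrite -(E mu) -(Ebar mu).
  by move=> /eigenspace_conditionsP/(_ v w Phi_v Phi_w).
(* The conditions are imposed at eigenvalues only; elsewhere they would hold
   trivially, both eigenspaces being 0. *)
rewrite negb_or => /andP[/negPn/eqP E0 /negPn/eqP Ebar0].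
by move: Phi_v Phi_w; rewrite E0 Ebar0 !memv0 => /eqP-> /eqP->.
Qed.
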